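(* Let $D$ be a strongly connected digraph that contains no subdivision of the oriented cycle $C(1,1,1,1,1,1)$ as a subdigraph. Then $\chi(D)\le 7\cdot 16^2$.
   Context: All graphs are simple. The chromatic number $\chi(D)$ of a digraph is the chromatic number of its underlying undirected graph. $C(1,1,1,1,1,1)$ is the oriented cycle of length $6$ whose six blocks (maximal directed subpaths) all have length $1$, i.e. the antidirected cycle of length $6$. A subdivision of a digraph $H$ is a digraph obtained from $H$ by replacing each arc $(x,y)$ by a directed path from $x$ to $y$ of length at least $1$, the new paths being internally disjoint. *)

(* Defs.v *)
From mathcomp Require Import all_boot.

Set Implicit Arguments.
Unset Strict Implicit.
Unset Printing Implicit Defensive.

(* Finite digraphs without loops or parallel arcs; the two arcs (x, y) and
   (y, x) may both be present. *)
Record digraph := Digraph {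
  vertex :> finType;
  arc : rel vertex;
  arc_irr : irreflexive arc }.

Definition strongly_connected (D : digraph) : Prop :=
  forall x y : D, connect (@arc D) x y.

Definition adjacent (D : digraph) : rel D := [rel x y | arc x y || arc y x].

Definition colorable (D : digraph) (k : nat) : bool :=
  [exists c : {ffun D -> 'I_k},
     [forall x, forall y, adjacent x y ==> (c x != c y)]].

Lemma colorable_exists (D : digraph) : exists k, colorable D k.
Proof.
exists #|D|; apply/existsP; exists [ffun x => enum_rank x].
apply/forallP=> x; apply/forallP=> y; apply/implyP; rewrite !ffunE.
by apply: contraTneq => /enum_rank_inj ->; rewrite /adjacent /= !arc_irr.
Qed.

Definition chromatic_number (D : digraph) : nat := ex_minn (colorable_exists D).

Definition is_subdigraph (S D : digraph) : Prop :=
  exists2 f : S -> D, injective f & forall u v, arc u v -> arc (f u) (f v).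

(* The digraph obtained from H by replacing each arc a = (x, y) by a directed
   path of length (l a).+1 from x to y, whose l a internal vertices are new:
   they are the vertices inr (a, i) with i < l a. *)
Section Subdivision.
Variable H : digraph.

Definition arc_type := {a : H * H | arc a.1 a.2}.

Variable l : arc_type -> nat.

Definition subdiv_vertex := (H + {a : arc_type & 'I_(l a)})%type.

Definition subdiv_path_tail (a : arc_type) : seq subdiv_vertex :=
  rcons [seq inr (Tagged (fun b => 'I_(l b)) i) | i <- enum 'I_(l a)]
        (inl (val a).2).

Definition subdiv_path (a : arc_type) : seq subdiv_vertex :=
  inl (val a).1 :: subdiv_path_tail a.

(* The pairs in the zip are those of consecutive vertices on the path. *)
Definition subdiv_arc : rel subdiv_vertex :=
  [rel u v | [exists a, (u, v) \in zip (subdiv_path a) (subdiv_path_tail a)]].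

Lemma subdiv_path_uniq a : uniq (subdiv_path a).
Proof.
rewrite /subdiv_path /subdiv_path_tail /= mem_rcons rcons_uniq inE negb_or.
apply/and3P; split.
- apply/andP; split; last by apply/mapP=> -[].
  apply/eqP=> -[E]; have := valP a; rewrite /= -E.
  by rewrite arc_irr.
- by apply/mapP=> -[].
- rewrite map_inj_uniq ?enum_uniq // => i j [] /eqP.
  by rewrite eq_Tagged => /eqP.
Qed.

Lemma subdiv_arc_irr : irreflexive subdiv_arc.
Proof.
move=> u; apply/negbTE; apply/existsP=> -[a].
have := subdiv_path_uniq a; rewrite /subdiv_path.
elim: (subdiv_path_tail a) (inl _) => //= y s IHs x /andP[xNys ysU].
rewrite inE => /orP[/eqP[-> E]|]; last exact: IHs.
by move: xNys; rewrite E mem_head.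
Qed.

Definition subdivision : digraph := Digraph subdiv_arc_irr.

End Subdivision.

Definition has_subdivision (H D : digraph) : Prop :=
  exists l : arc_type H -> nat, is_subdigraph (subdivision l) D.

(* C(1,1,1,1,1,1): on the 6-cycle 0, 1, ..., 5, every edge is directed from its
   even end to its odd end. *)
Definition antidirected_C6_arc : rel 'I_6 :=
  [rel i j : 'I_6 | ~~ odd i && ((j == ordS i) || (i == ordS j))].

Lemma antidirected_C6_arc_irr : irreflexive antidirected_C6_arc.
Proof. by case; do 6?case. Qed.

Definition antidirected_C6 : digraph := Digraph antidirected_C6_arc_irr.

(* Main.v *)
(* Take a breadth-first out-tree from a root r.  An arc from level i to level
   i + 1 is properly coloured by the parity of the level, so it suffices to
   colour the graph of the arcs that do not increase the level, and that graph
   is 22-degenerate: otherwise some nonempty set E of such arcs has all nonzero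
   out-degrees at least 10 and all nonzero in-degrees at least 3.  Let y be a
   head of E of maximal level, x1, x2, x3 three of its in-neighbours, and choose
   disjoint pairs p_i, q_i of further out-neighbours of the x_i.  No tree path
   ending at some p_i or q_i passes through y or any x_j, for want of levels.
   If z in {p_i, q_i} and z' in {p_j, q_j}, i != j, are unrelated in the tree,
   the paths from their last common ancestor s close z <- x_i -> y <- x_j -> z'
   into a subdivision of C(1,1,1,1,1,1) with sources s, x_i, x_j.
   If all such z, z' are related, order the indices so that
   lev p_a <= lev p_b <= lev p_c <= lev q_c and lev p_b <= lev q_b: the tree path
   from p_a to p_b lies below the level of q_b and p_c, hence is disjoint from
   the tree path between those two, and the two paths together with y link
   x_a, x_b, x_c into the forbidden subdivision. *)

(* [Defs] comes last because [path] also defines a function [arc]. *)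
From mathcomp Require Import all_boot zify.
Require Import Defs.

Set Implicit Arguments.
Unset Strict Implicit.
Unset Printing Implicit Defensive.

(** * Subdivisions built from internally disjoint paths *)

Lemma path_map_zip (T U : eqType) (e : rel U) (f : T -> U) x s u w :
  path e (f x) (map f s) -> (u, w) \in zip (x :: s) s -> e (f u) (f w).
Proof.
elim: s x => //= y s IHs x /andP[exy pys].
by rewrite inE => /predU1P[[-> ->] //|]; exact: IHs.
Qed.

(** The entries of [q a] serve as the new vertices on the arc [a], which dictates the lengths; the
    disjointness conditions make the vertex map injective. *)
Lemma has_subdivision_paths (H D : digraph) (v : H -> D)
    (q : arc_type H -> seq D) :
  injective v ->
  (forall a, path (@arc D) (v (val a).1) (rcons (q a) (v (val a).2))) ->
  (forall a, uniq (q a)) ->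
  (forall a x, v x \notin q a) ->
  (forall a b z, z \in q a -> z \in q b -> a = b) ->
  has_subdivision H D.
Proof.
move=> v_inj q_path q_uniq vNq q_disj; exists (fun a => size (q a)).
pose f (u : subdiv_vertex (fun a => size (q a))) : D :=
  match u with
  | inl x => v x
  | inr t => tnth (in_tuple (q (tag t))) (tagged t)
  end.
have f_in t : f (inr t) \in q (tag t) by apply: (mem_tnth (tagged t)).
exists f => [u w|u w /existsP[a]].
  case: u w => [x|s] [y|t] E.
  - by rewrite (v_inj _ _ E).
  - by have := vNq (tag t) x; rewrite [v x]E f_in.
  - by have := vNq (tag s) y; rewrite -[v y]E f_in.
  - have tag_st := q_disj _ _ _ (f_in s); rewrite E in tag_st.
    move: (tag_st _ (f_in t)) E; clear tag_st.
    case: s t => [a i] [b j] /= ab; move: i; rewrite ab {a ab} => i.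
    rewrite !(tnth_nth (v (val b).1)) /= => /eqP.
    by rewrite nth_uniq // => /eqP /val_inj ->.
apply: path_map_zip; rewrite /subdiv_path_tail map_rcons -map_comp /=.
suff -> : map (f \o (fun i => inr (Tagged (fun b => 'I_(size (q b))) i)))
             (enum 'I_(size (q a))) = q a by exact: q_path.
by rewrite -[RHS](map_tnth_enum (in_tuple (q a))); apply: eq_map.
Qed.

(* Two consecutive blocks of an oriented cycle: x and x' are the sources, t is
   the sink, and W contains all other vertices of the two blocks. *)
Definition confluent (D : digraph) (W : {pred D}) (x x' : D) :=
  exists t q q', [/\ path (@arc D) x (rcons q t), path (@arc D) x' (rcons q' t),
    uniq (t :: q ++ q') & {subset t :: q ++ q' <= W}].

Lemma nth_flatten_disjoint (T : eqType) (ss : seq (seq T)) i j z :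
  uniq (flatten ss) ->
  z \in nth [::] ss i -> z \in nth [::] ss j -> i = j.
Proof.
have mem_flat k tt : z \in nth [::] tt k -> z \in flatten tt.
  by elim: tt k => [|t tt IH] [|k] //=; rewrite mem_cat; [move->|move/IH->; rewrite orbT].
elim: ss i j => [|s ss IHs] [|i] [|j] //=; rewrite cat_uniq => /and3P[_ /hasPn sN ssU].
- by move=> zs /mem_flat /sN; rewrite /= zs.
- by move=> /mem_flat /sN; rewrite /= => /negP.
- by move=> zi zj; rewrite (IHs i j).
Qed.

(** The regions are predicates rather than lists, so that disjointness can later be checked by
    comparing tree levels. *)
Lemma antidirected_C6_confluent (D : digraph) (W1 W3 W5 : {pred D}) (x0 x2 x4 : D) :
  uniq [:: x0; x2; x4] ->
  {in [:: x0; x2; x4], forall x, [&& x \notin W1, x \notin W3 & x \notin W5]} ->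
  [predI W1 & W3] =i pred0 -> [predI W1 & W5] =i pred0 ->
  [predI W3 & W5] =i pred0 ->
  confluent W1 x0 x2 -> confluent W3 x2 x4 -> confluent W5 x4 x0 ->
  has_subdivision antidirected_C6 D.
Proof.
move=> xU xW W13 W15 W35 [t1 [q0 [q1 [P0 P1 U1 S1]]]].
move=> [t3 [q2 [q3 [P2 P3 U3 S3]]]] [t5 [q4 [q5 [P4 P5 U5 S5]]]].
(* Even positions of [vs] hold sources, odd ones sinks; entry [i] of [qs] is the interior of the
   path joining positions [i] and [i + 1] modulo 6. *)
pose vs := [:: x0; t1; x2; t3; x4; t5].
pose qs := [:: q0; q1; q2; q3; q4; q5].
have disj (A B : {pred D}) (s t : seq D) : [predI A & B] =i pred0 ->
    {subset s <= A} -> {subset t <= B} -> ~~ has (mem s) t.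
  move=> AB sA tB; apply/hasPn => z /tB zB; apply/negP => /sA zA.
  by have := AB z; rewrite !inE zA zB.
have xdisj (W : {pred D}) (s : seq D) : {in [:: x0; x2; x4], forall x, x \notin W} ->
    {subset s <= W} -> ~~ has (mem [:: x0; x2; x4]) s.
  by move=> xNW sW; apply/hasPn => z /sW zW; apply: contraL zW => /xNW.
have cat4U (A B C E : seq D) : uniq A -> uniq B -> uniq C -> uniq E ->
    ~~ has (mem A) B -> ~~ has (mem A) C -> ~~ has (mem A) E ->
    ~~ has (mem B) C -> ~~ has (mem B) E -> ~~ has (mem C) E ->
    uniq (A ++ B ++ C ++ E).
  move=> AU BU CU EU AB AC AE BC BE CE.
  by rewrite !cat_uniq !has_cat !negb_or AU BU CU EU AB AC AE BC BE CE.
have UU : uniq (vs ++ flatten qs).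
  have /perm_uniq -> : perm_eq (vs ++ flatten qs) ([:: x0; x2; x4] ++
      (t1 :: q0 ++ q1) ++ (t3 :: q2 ++ q3) ++ (t5 :: q4 ++ q5)).
    apply/permP => P; rewrite !(count_cat, cats0) /= !count_cat.
    clear; lia.
  apply: cat4U => //; first [exact: disj S1 S3|exact: disj S1 S5|
    exact: disj S3 S5|idtac].
  - by apply: (xdisj W1) => // x /xW /and3P[].
  - by apply: (xdisj W3) => // x /xW /and3P[].
  - by apply: (xdisj W5) => // x /xW /and3P[].
have [vsU vsN qsU] : [/\ uniq vs, ~~ has (mem vs) (flatten qs) & uniq (flatten qs)].
  by move: UU; rewrite cat_uniq => /and3P[].
(* idx a = i when the arc a joins i and ordS i. *)
pose idx (a : arc_type antidirected_C6) : 'I_6 :=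
  if (val a).2 == ordS (val a).1 then (val a).1 else (val a).2.
have idxP a : val a = if odd (idx a) then (ordS (idx a), idx a)
                      else (idx a, ordS (idx a)).
  case: a => -[i j] ij; have /= /andP[iE] := ij; rewrite /idx /=.
  case: eqP => [-> _|_ /= /eqP ijS]; first by rewrite (negbTE iE).
  suff -> : odd j by rewrite ijS.
  by move: iE; rewrite {}ijS; case: j {ij} => -[|[|[|[|[|[|]]]]]].
apply: (@has_subdivision_paths antidirected_C6 D (fun i : 'I_6 => nth x0 vs i)
          (fun a => nth [::] qs (idx a))).
- by move=> i j /eqP; rewrite nth_uniq // => /eqP /val_inj.
- move=> a; rewrite idxP; case: (idx a) => -[|[|[|[|[|[|]]]]]] //= _.
- move=> a; move: qsU; rewrite /= cats0 !cat_uniq.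
  move=> /and5P[? _ ? _ /and5P[? _ ? _ /andP[? /andP[_ ?]]]].
  by case: (idx a) => -[|[|[|[|[|[|]]]]]].
- move=> a i; apply: contra vsN => ia; apply/hasP; exists (nth x0 vs i).
    by apply/flattenP; exists (nth [::] qs (idx a)); rewrite ?mem_nth.
  by rewrite /= mem_nth.
move=> a b z za zb; apply: val_inj; rewrite !idxP.
by rewrite (ord_inj (nth_flatten_disjoint qsU za zb)).
Qed.

Lemma confluent_sym (D : digraph) (W : {pred D}) (x x' : D) :
  confluent W x x' -> confluent W x' x.
Proof.
move=> [t [q [q' [P P' U S]]]]; exists t, q', q.
have E : perm_eq (t :: q' ++ q) (t :: q ++ q') by rewrite perm_cons perm_catC.
by split=> // [|z]; rewrite ?(perm_uniq E) // (perm_mem E); apply: S.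
Qed.

(** * Rooted trees with levels, and arcs that do not increase the level *)

Section LeveledTree.

Variables (D : digraph) (r : D) (lev : D -> nat) (par : D -> D).
Hypothesis lev0 : forall x, lev x = 0 -> x = r.
Hypothesis parP :
  forall x, 0 < lev x -> arc (par x) x /\ (lev (par x)).+1 = lev x.

(** Truncated subtraction makes this [x] itself once [i] exceeds [lev x]. *)
Definition ancestor_at (x : D) (i : nat) : D := iter (lev x - i) par x.

Lemma lev_ancestor_at x i : i <= lev x -> lev (ancestor_at x i) = i.
Proof.
move=> lei; rewrite -[RHS](subKn lei) /ancestor_at.
elim: (lev x - i) (leq_subr i (lev x)) => [|k IHk] ltk; first by rewrite subn0.
by have := IHk (ltnW ltk); have := @parP (iter k par x); rewrite /=; lia.
Qed.

Lemma ancestor_at_lev x : ancestor_at x (lev x) = x.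
Proof. by rewrite /ancestor_at subnn. Qed.

Lemma arc_ancestor_at x i :
  i < lev x -> arc (ancestor_at x i) (ancestor_at x i.+1).
Proof.
move=> lti; have -> : ancestor_at x i = par (ancestor_at x i.+1).
  by rewrite /ancestor_at -iterS; congr (iter _ _ _); lia.
by have [] := @parP (ancestor_at x i.+1); rewrite ?lev_ancestor_at.
Qed.

Lemma path_ancestor_at y i n : i + n = lev y ->
  path (@arc D) (ancestor_at y i) [seq ancestor_at y j | j <- iota i.+1 n].
Proof.
elim: n i => //= n IHn i iE; rewrite arc_ancestor_at ?IHn //; lia.
Qed.

(* The vertices of level at least i on the tree path from the root to y. *)
Definition branch (y : D) (i : nat) : {pred D} :=
  [pred z | (i <= lev z <= lev y) && (z == ancestor_at y (lev z))].

Lemma notin_branch y i z : lev y <= lev z -> z != y -> z \notin branch y i.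
Proof.
move=> yz zNy; apply: contra zNy; rewrite inE => /andP[/andP[_ zy] /eqP zE].
by rewrite zE (_ : lev z = lev y) ?ancestor_at_lev //; lia.
Qed.

(** The sink is [y]: the path from [x] enters the branch at level [i] and follows the tree, the one
    from [x'] is a single arc. *)
Lemma confluent_branch x x' y i :
  i <= lev y -> arc x (ancestor_at y i) -> arc x' y ->
  confluent (branch y i) x x'.
Proof.
move=> iy xy x'y.
pose q := [seq ancestor_at y j | j <- iota i (lev y - i)].
have qE : rcons q y = [seq ancestor_at y j | j <- iota i (lev y - i).+1].
  by rewrite -addn1 iotaD map_cat /= cats1 subnKC // ancestor_at_lev.
exists y, q, [::]; rewrite cats0; split.
- by rewrite qE /= xy path_ancestor_at ?subnKC.
- by rewrite /= x'y.
- suff: uniq (rcons q y) by rewrite rcons_uniq.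
  rewrite qE map_inj_in_uniq ?iota_uniq // => j k.
  rewrite !mem_iota => jI kI /(congr1 lev); rewrite !lev_ancestor_at //; lia.
- move=> z; rewrite -mem_rcons qE => /mapP[j]; rewrite mem_iota => jI ->.
  by rewrite inE lev_ancestor_at ?eqxx; lia.
Qed.

Hypothesis no_C6 : ~ has_subdivision antidirected_C6 D.

(** Otherwise the branches to [p] and [p'] below their last common ancestor, together with [y], are
    the three regions of a forbidden subdivision. Equal levels would force [p = p']. *)
Lemma out_neighbours_related y x x' p p' :
  arc x y -> arc x' y -> arc x p -> arc x' p' -> uniq [:: x; x'; y; p; p'] ->
  lev y <= lev x -> lev y <= lev x' -> lev p <= lev p' <= lev y ->
  lev p < lev p' /\ p = ancestor_at p' (lev p).
Proof.
move=> xy x'y xp x'p' U yx yx' /andP[pp' p'y].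
have [pE|pN] := eqVneq p (ancestor_at p' (lev p)).
  split=> //; rewrite ltn_neqAle pp' andbT; apply: contraTneq U => lp.
  have -> : p = p' by rewrite pE lp ancestor_at_lev.
  by rewrite /= !inE eqxx !andbF.
(* The largest level of a common ancestor; level 0 always qualifies because only the root lies
   there. *)
pose Q i := (i <= lev p) && (ancestor_at p i == ancestor_at p' i).
have exQ : exists i, Q i.
  by exists 0; apply/eqP; rewrite [LHS]lev0 ?[RHS]lev0 ?lev_ancestor_at.
have Q_le i : Q i -> i <= lev p by case/andP.
case: (ex_maxnP exQ Q_le) => i /andP[ip /eqP sE] i_max.
have {}ip : i < lev p.
  rewrite ltn_neqAle ip andbT; apply: contra_neq pN => iE.
  by rewrite -iE -sE iE ancestor_at_lev.
have levs : lev (ancestor_at p i) = i by rewrite lev_ancestor_at // ltnW.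
set s := ancestor_at p i in sE levs.
have sN z : lev p <= lev z -> s != z by apply: contraTneq => <-; lia.
have [px px' py] : [/\ lev p <= lev x, lev p <= lev x' & lev p <= lev y].
  by split; lia.
have [p'x p'x' ip'] : [/\ lev p' <= lev x, lev p' <= lev x' & i < lev p'].
  by split; lia.
move: U; rewrite /= !inE !negb_or => /and5P[/and4P[xx' xNy xNp xNp']
  /and3P[x'Ny x'Np x'Np'] /andP[yNp yNp'] _ _].
exfalso; apply: no_C6.
apply: (@antidirected_C6_confluent D (branch p i.+1) (pred1 y) (branch p' i.+1) s x x').
- by rewrite /= !inE !negb_or xx' !sN.
- move=> z; rewrite !inE => /or3P[] /eqP->.
  + by rewrite levs ltnn /= sN.
  + by rewrite xNy !notin_branch.
  + by rewrite x'Ny !notin_branch.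
- move=> z; rewrite !inE andbC; case: eqP => //= ->.
  exact/negbTE/notin_branch.
- move=> z; apply/negbTE/negP; rewrite !inE.
  move=> /andP[/andP[/andP[iz zp] /eqP zE] /andP[_ /eqP zE']].
  (* A vertex on both branches would be a common ancestor at a level above the maximal [i]. *)
  have := i_max (lev z); rewrite /Q zp -zE -zE' eqxx leqNgt iz.
  by move/(_ isT).
- move=> z; rewrite !inE; case: eqP => //= ->.
  exact/negbTE/notin_branch.
- by apply: confluent_branch => //; apply: arc_ancestor_at.
- exists y, [::], [::]; rewrite /= xy x'y; split=> // z.
  by rewrite !inE.
- apply: confluent_sym; apply: confluent_branch => //.
  by rewrite sE; apply: arc_ancestor_at.
Qed.

Lemma out_neighbours_not_sorted y xa xb xc a b b' c :
  [/\ arc xa y, arc xb y & arc xc y] ->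
  [/\ arc xa a, arc xb b, arc xb b' & arc xc c] ->
  uniq [:: xa; xb; xc; y; a; b; b'; c] ->
  [/\ lev y <= lev xa, lev y <= lev xb & lev y <= lev xc] ->
  [/\ lev a <= lev b <= lev y, lev b <= lev b' <= lev y &
      lev b <= lev c <= lev y] ->
  False.
Proof.
move=> [aay aby acy] [xaa xbb xbb' xcc] U [ya yb yc].
move=> [/andP[ab b_y] /andP[bb' b'y] /andP[bc cy]].
have mU := mask_uniq U.
have [ltab aE] : lev a < lev b /\ a = ancestor_at b (lev a).
  apply: (@out_neighbours_related y xa xb) => //; last by lia.
  exact: (mU [:: true; true; false; true; true; true]).
have [ltbc bE] : lev b < lev c /\ b = ancestor_at c (lev b).
  apply: (@out_neighbours_related y xb xc) => //; last by lia.
  exact: (mU [:: false; true; true; true; false; true; false; true]).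
have rel_b'c : lev b' <= lev c -> lev b' < lev c /\ b' = ancestor_at c (lev b').
  move=> b'c; apply: (@out_neighbours_related y xb xc) => //; last by lia.
  exact: (mU [:: false; true; true; true; false; false; true; true]).
have rel_cb' : lev c <= lev b' -> lev c < lev b' /\ c = ancestor_at b' (lev c).
  move=> b'c; apply: (@out_neighbours_related y xc xb) => //; last by lia.
  rewrite (@perm_uniq _ _ [:: xb; xc; y; b'; c]).
    exact: (mU [:: false; true; true; true; false; false; true; true]).
  by apply/permP => P /=; clear; lia.
have bNb' : b != b'.
  have := mU [:: false; false; false; false; false; true; true].
  by rewrite /= inE andbT.
(* At equal levels, [b] and [b'] would both be the ancestor of [c] at that level. *)
have {bb'} ltbb' : lev b < lev b'.
  rewrite ltn_neqAle bb' andbT; apply: contra_neq bNb' => E.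
  by have [|_ ->] := rel_b'c; rewrite -E // ltnW.
(* [w] is the higher of [b'] and [c], and [j] is the level of the lower one, an ancestor of [w]. As
   [j] exceeds [lev b], this branch misses the one from [a] to [b]. *)
have [w [j [ltbj w_bc W]]] : exists w j, [/\ lev b < j, w \in [:: b'; c] &
    confluent (branch w j) xb xc].
  have [b'c|/ltnW cb'] := leqP (lev b') (lev c).
    exists c, (lev b'); rewrite !inE eqxx orbT; split=> //.
    by apply: confluent_branch => //; have [_ <-] := rel_b'c b'c.
  exists b', (lev c); rewrite !inE eqxx; split=> //.
  apply: confluent_sym; apply: confluent_branch => //.
  by have [_ <-] := rel_cb' cb'.
have wy : lev w <= lev y by move: w_bc; rewrite !inE => /orP[] /eqP->.
have [wxa wxb wxc] : [/\ lev w <= lev xa, lev w <= lev xb & lev w <= lev xc].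
  by split; apply: leq_trans wy _.
have [bxa bxb bxc] : [/\ lev b <= lev xa, lev b <= lev xb & lev b <= lev xc].
  by split; apply: leq_trans b_y _.
have branchN : [predI branch b (lev a) & branch w j] =i pred0.
  move=> z; apply/negbTE/negP; rewrite !inE.
  move=> /andP[/andP[/andP[_ zb] _] /andP[/andP[jz _] _]].
  by have := leq_trans ltbj (leq_trans jz zb); rewrite ltnn.
move: U; rewrite /= !inE !negb_or.
move=> /and5P[/and5P[xab xac xay xaNa /and3P[xaNb xaNb' xaNc]]
  /and5P[xbc xby xbNa xbNb /andP[xbNb' xbNc]]
  /and5P[xcy xcNa xcNb xcNb' xcNc] /and4P[yNa yNb yNb' yNc] _].
have [xaw xbw xcw yw] : [/\ xa != w, xb != w, xc != w & y != w].
  by move: w_bc; rewrite !inE => /orP[] /eqP->.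
apply: no_C6.
apply: (@antidirected_C6_confluent D (branch b (lev a)) (branch w j) (pred1 y) xa xb xc).
- by rewrite /= !inE negb_or xab xac xbc.
- by move=> z; rewrite !inE => /or3P[] /eqP->;
    rewrite ?xay ?xby ?xcy andbT !notin_branch.
- exact: branchN.
- move=> z; rewrite !inE andbC; case: eqP => //= ->.
  exact/negbTE/notin_branch.
- move=> z; rewrite !inE andbC; case: eqP => //= ->.
  exact/negbTE/notin_branch.
- by apply: confluent_branch ; rewrite -?aE // ltnW.
- exact: W.
- exists y, [::], [::]; rewrite /= aay acy; split=> // z.
  by rewrite !inE.
Qed.

(** Freshness is stated as an equation between [uniq] conditions, so that successive choices chain
    by rewriting. *)
Lemma two_outside (N : {set D}) (s : seq D) :
  size s + 1 < #|N| -> exists p p',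
    [/\ p \in N, p' \in N, uniq (p :: p' :: s) = uniq s & lev p <= lev p'].
Proof.
move=> ltN; have /card_gt1P[p [p' [pN p'N pp']]] : 1 < #|N :\: [set z in s]|.
  have sS : #|[set z in s]| <= size s by rewrite cardsE card_size.
  have := cardsID [set z in s] N; have := subset_leq_card (subsetIr N [set z in s]).
  by move: ltN sS; clear; lia.
move: pN p'N; rewrite !inE => /andP[pNs pN] /andP[p'Ns p'N].
have [lp|/ltnW lp] := leqP (lev p) (lev p').
  by exists p, p'; rewrite /= inE negb_or pp' pNs p'Ns.
by exists p', p; rewrite /= inE negb_or eq_sym pp' pNs p'Ns.
Qed.

Lemma no_dense_back_arcs (E : {set D * D}) :
  {in E, forall e, arc e.1 e.2 /\ lev e.2 <= lev e.1} ->
  {in E, forall e, 9 < #|[set z | (e.1, z) \in E]|} ->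
  {in E, forall e, 2 < #|[set z | (z, e.2) \in E]|} ->
  E = set0.
Proof.
move=> arcE outE innE; apply/eqP; apply/set0Pn => -[e0 e0E].
case: (@arg_maxnP _ e0 (mem E) (fun e => lev e.2) e0E) => -[x0 y] /= eE y_max.
have /card_gt2P[x1 [x2 [x3 [[x1y x2y x3y] [x12 x23 x31]]]]] := innE _ eE.
rewrite !inE in x1y x2y x3y.
have [p1 [q1 [p1N q1N U1 le1]]] := two_outside
  (leq_trans (isT : size [:: x1; x2; x3; y] + 1 < 10) (outE _ x1y)).
have [p2 [q2 [p2N q2N U2 le2]]] := two_outside
  (leq_trans (isT : size [:: p1; q1; x1; x2; x3; y] + 1 < 10) (outE _ x2y)).
(* Eight vertices must be avoided here; with the two new ones this accounts for out-degree 10. *)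
have [p3 [q3 [p3N q3N U3 le3]]] := two_outside
  (leq_trans (isT : size [:: p2; q2; p1; q1; x1; x2; x3; y] + 1 < 10) (outE _ x3y)).
rewrite !inE /= in p1N q1N p2N q2N p3N q3N.
have arcP x z : (x, z) \in E -> arc x z /\ lev z <= lev y.
  by move=> xzE; have [] := arcE _ xzE; split=> //; apply: y_max xzE.
pose fan x p q := [/\ arc x y, lev y <= lev x, arc x p, arc x q &
                      lev p <= lev q <= lev y].
have fanP x p q : (x, y) \in E -> (x, p) \in E -> (x, q) \in E ->
    lev p <= lev q -> fan x p q.
  move=> /arcE[/= xy yx] /arcP[xp _] /arcP[xq qy] pq.
  by split=> //; rewrite pq qy.
have F1 := fanP _ _ _ x1y p1N q1N le1; have F2 := fanP _ _ _ x2y p2N q2N le2.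
have F3 := fanP _ _ _ x3y p3N q3N le3.
have U : uniq [:: p3; q3; p2; q2; p1; q1; x1; x2; x3; y].
  have yN x : (x, y) \in E -> x != y.
    by move=> /arcP[xy _]; apply: contraTneq xy => ->; rewrite arc_irr.
  by rewrite U3 U2 U1 /= !inE !negb_or x12 x23 (eq_sym x1 x3) x31 !yN.
(* Stated for every permutation of the fans, to cover each order of the levels of [p1], [p2],
   [p3]. *)
have not_sorted xa a a' xb b b' xc c c' :
    perm_eq ([:: xa; xb; xc; y; a; b; b'; c] ++ [:: a'; c'])
            [:: p3; q3; p2; q2; p1; q1; x1; x2; x3; y] ->
    fan xa a a' -> fan xb b b' -> fan xc c c' -> lev a <= lev b <= lev c -> False.
  move=> /perm_uniq; rewrite U cat_uniq => /andP[abcU _].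
  move=> [xay yxa xaa _ _] [xby yxb xbb xbb' /andP[bb' b'y]].
  move=> [xcy yxc xcc _ /andP[cc' c'y]] /andP[ab bc].
  apply: (out_neighbours_not_sorted _ _ abcU) => //; split=> //.
  - by rewrite ab (leq_trans bb').
  - by rewrite bb'.
  - by rewrite bc (leq_trans cc').
clear -F1 F2 F3 not_sorted.
have [l12|/ltnW l21] := leqP (lev p1) (lev p2);
  have [l23|/ltnW l32] := leqP (lev p2) (lev p3);
  have [l13|/ltnW l31] := leqP (lev p1) (lev p3).
- apply: not_sorted F1 F2 F3 _; last by rewrite l12.
  by apply/permP => P /=; do 10![move: (nat_of_bool _) => ?]; lia.
- apply: not_sorted F1 F2 F3 _; last by rewrite l12.
  by apply/permP => P /=; do 10![move: (nat_of_bool _) => ?]; lia.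
- apply: not_sorted F1 F3 F2 _; last by rewrite l13.
  by apply/permP => P /=; do 10![move: (nat_of_bool _) => ?]; lia.
- apply: not_sorted F3 F1 F2 _; last by rewrite l31.
  by apply/permP => P /=; do 10![move: (nat_of_bool _) => ?]; lia.
- apply: not_sorted F2 F1 F3 _; last by rewrite l21.
  by apply/permP => P /=; do 10![move: (nat_of_bool _) => ?]; lia.
- apply: not_sorted F2 F3 F1 _; last by rewrite l23.
  by apply/permP => P /=; do 10![move: (nat_of_bool _) => ?]; lia.
- apply: not_sorted F3 F2 F1 _; last by rewrite l32.
  by apply/permP => P /=; do 10![move: (nat_of_bool _) => ?]; lia.
- apply: not_sorted F3 F2 F1 _; last by rewrite l32.
  by apply/permP => P /=; do 10![move: (nat_of_bool _) => ?]; lia.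
Qed.

End LeveledTree.

(** * Breadth-first trees *)

Lemma exists_bfs_tree (D : digraph) (r : D) :
  (forall x, connect (@arc D) r x) ->
  exists (lev : D -> nat) (par : D -> D),
    [/\ forall x, lev x = 0 -> x = r,
        forall x, 0 < lev x -> arc (par x) x /\ (lev (par x)).+1 = lev x &
        forall x y, arc x y -> lev y <= (lev x).+1].
Proof.
move=> r_conn.
(* The ends of walks from [r] with exactly [k] arcs; the least such [k] is the distance from [r]. *)
pose reach k := iter k (fun S : {set D} => [set x | [exists w in S, arc w x]]) [set r].
have reachS k x w : w \in reach k -> arc w x -> x \in reach k.+1.
  by move=> wk wx; rewrite /= inE; apply/exists_inP; exists w.
have exk x : exists k, x \in reach k.
  have /connectP[p pP ->] := r_conn x; exists (size p).
  elim/last_ind: p pP => [|p z IHp]; first by rewrite inE.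
  rewrite rcons_path last_rcons size_rcons => /andP[/IHp lp]; exact: reachS.
pose lev x := ex_minn (exk x).
have levP x : x \in reach (lev x) by rewrite /lev; case: ex_minnP.
have lev_le x k : x \in reach k -> lev x <= k.
  by rewrite /lev; case: ex_minnP => m _; apply.
have lev_arc x y : arc x y -> lev y <= (lev x).+1.
  by move=> xy; apply: lev_le; apply: reachS (levP x) xy.
(* The default [x] is taken at level 0 only. *)
exists lev, (fun x => odflt x [pick w | arc w x && ((lev w).+1 == lev x)]); split=> //.
- by move=> x x0; have := levP x; rewrite x0 inE => /eqP.
- move=> x; case: pickP => [w /andP[wx /eqP //]|no_w] x_gt0.
  exfalso; have := levP x; case xk: (lev x) x_gt0 => [//|k] _.
  rewrite /= inE => /exists_inP[w wk wx]; have := no_w w.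
  have /eqP -> : lev w == k by rewrite eqn_leq lev_le //= -ltnS -xk lev_arc.
  by rewrite wx xk eqxx.
Qed.

(** * Greedy colouring and dense cores *)

(** Delete a vertex of degree at most [k], colour the rest by induction, and give it a colour
    missing from its neighbours. *)
Lemma degenerate_coloring (T : finType) (e : rel T) k :
  symmetric e -> irreflexive e ->
  (forall S : {set T}, S != set0 ->
     exists2 v, v \in S & #|[set u in S | e v u]| <= k) ->
  exists c : T -> 'I_k.+1, forall x y, e x y -> c x != c y.
Proof.
move=> e_sym e_irr degen.
suff [c cP] : exists c : T -> 'I_k.+1,
    {in [set: T] &, forall x y, e x y -> c x != c y}.
  by exists c => x y; apply: cP; rewrite inE.
move: [set: T] => S; have [n] := ubnP #|S|; elim: n S => // n IHn S.
have [-> _|/degen[v vS deg_v] leS] := eqVneq S set0.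
  by exists (fun=> ord0) => x; rewrite inE.
have [|c cP] := IHn (S :\ v); first by move: leS; rewrite (cardsD1 v) vS.
have [i iN] : exists i, i \notin c @: [set u in S | e v u].
  apply/existsP; rewrite -negb_forall; apply: contraTN deg_v => /forallP cT.
  rewrite -ltnNge; apply: leq_trans (leq_imset_card c _).
  by rewrite -[X in X <= _]card_ord subset_leq_card //; apply/subsetP => i _.
have cvP x : x \in S -> e v x -> i != c x.
  by move=> xS vx; apply: contraNneq iN => ->; rewrite imset_f // inE xS.
exists (fun x => if x == v then i else c x) => x y xS yS.
have [->|xv] := eqVneq x v; have [->|yv] := eqVneq y v.
- by rewrite e_irr.
- exact: cvP.
- by rewrite e_sym eq_sym; apply: cvP.
- by apply: cP; rewrite !inE ?xv ?yv.
Qed.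

(* The bipartite multigraph with edge set E and endpoint maps f and g: take a
   minimal subset still satisfying the inequality. *)
Lemma dense_core (I T : finType) (f g : I -> T) (a b : nat) (E : {set I}) :
  a * #|f @: E| + b * #|g @: E| < #|E| ->
  exists E' : {set I}, [/\ E' \subset E, E' != set0,
    {in E', forall e, a < #|[set e' in E' | f e' == f e]|} &
    {in E', forall e, b < #|[set e' in E' | g e' == g e]|}].
Proof.
(* Abstracting the maps and constants lets the fibre bound be reused with [f] and [g] exchanged. *)
pose P (f g : I -> T) a b (A : {set I}) := a * #|f @: A| + b * #|g @: A| < #|A|.
have large_fiber f' g' a' b' A : P f' g' a' b' A ->
    (forall B : {set I}, P f' g' a' b' B -> B \subset A -> B = A) ->
    {in A, forall e, a' < #|[set e' in A | f' e' == f' e]|}.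
  move=> PA Amin e eA; rewrite ltnNge; apply/negP => small.
  pose F := [set e' in A | f' e' == f' e].
  have eF : e \in F by rewrite inE eA /=.
  (* Deleting a fibre of at most [a'] elements lowers the left side by at least [a'] and the right
     by at most [a'], so the inequality survives, against minimality. *)
  suff AFA : A :\: F = A by move: eA; rewrite -AFA inE eF.
  apply: Amin; last exact: subsetDl.
  have fF : f' @: (A :\: F) \subset (f' @: A) :\ f' e.
    apply/subsetP => _ /imsetP[e' /setDP[e'A e'F] ->]; rewrite 2!inE imset_f // andbT.
    by apply: contra e'F => fe; rewrite inE e'A.
  have := subset_leq_card (imsetS g' (subsetDl A F)).
  have := subset_leq_card fF; have := cardsD1 (f' e) (f' @: A).
  rewrite imset_f // => fA fF_le gF_le.
  have FA : F \subset A by apply/subsetP => z; rewrite inE => /andP[].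
  have := cardsID F A; rewrite (setIidPr FA) => AE.
  move: PA; rewrite /P fA -AE mulnDr muln1 -addnA => PA.
  rewrite -(ltn_add2l #|F|); apply: leq_trans PA.
  by rewrite ltnS leq_add // leq_add // leq_mul.
move=> PE; have [A /minsetP[PA Amin] AE] : {A | minset (P f g a b) A & A \subset E}.
  exact: minset_exists.
exists A; split=> //.
- by apply: contraTneq PA => ->; rewrite /P cards0.
- exact: (large_fiber f g a b).
- by apply: (large_fiber g f b a) => [|B]; rewrite /P addnC //; apply: Amin.
Qed.

Lemma colorable_card (D : digraph) (C : finType) (c : D -> C) :
  (forall x y, adjacent x y -> c x != c y) -> colorable D #|C|.
Proof.
move=> cP; apply/existsP; exists [ffun x => enum_rank (c x)].
apply/forallP => x; apply/forallP => y; apply/implyP => /cP; rewrite !ffunE.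
by apply: contra_neq => /enum_rank_inj.
Qed.

Lemma sum_fibers (I T : finType) (f : I -> T) (E : {set I}) (S : {set T}) :
  f @: E \subset S -> \sum_(v in S) #|[set e in E | f e == v]| = #|E|.
Proof.
move=> /subsetP fS; rewrite -[RHS]sum1_card.
rewrite (partition_big f (mem S)) => [|e eE]; last by apply: fS; rewrite imset_f.
by apply: eq_bigr => v _; rewrite sum1dep_card; apply: eq_card => e; rewrite !inE.
Qed.

(** If all degrees inside [S] exceed [2 * (a + b)], summing out- and in-degrees yields more than
    [(a + b) * #|S|] arcs, and [dense_core] applies to their tails and heads. *)
Lemma degenerate_or_dense_core (T : finType) (B : rel T) (a b : nat) (S : {set T}) :
  S != set0 ->
  (exists2 v, v \in S & #|[set u in S | B v u || B u v]| <= (a + b).*2) \/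
  exists E : {set T * T}, [/\ {in E, forall e, B e.1 e.2}, E != set0,
    {in E, forall e, a < #|[set z | (e.1, z) \in E]|} &
    {in E, forall e, b < #|[set z | (z, e.2) \in E]|}].
Proof.
move=> S0.
have [/exists_inP|] := boolP [exists v in S,
    #|[set u in S | B v u || B u v]| <= (a + b).*2]; first by left.
rewrite negb_exists_in => /forall_inP deg; right.
pose E := [set e : T * T | [&& e.1 \in S, e.2 \in S & B e.1 e.2]].
have fS : fst @: E \subset S.
  by apply/subsetP => _ /imsetP[e eE ->]; move: eE; rewrite inE => /and3P[].
have gS : snd @: E \subset S.
  by apply/subsetP => _ /imsetP[e eE ->]; move: eE; rewrite inE => /and3P[].
have ltE : (a + b) * #|S| < #|E|.
  rewrite -ltn_double -[X in _ < X]addnn -{1}(sum_fibers fS) -(sum_fibers gS).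
  rewrite -big_split /= doubleMl mulnC -sum_nat_const.
  have [v vS] := set0Pn _ S0.
  have le_deg w : w \in S -> (a + b).*2 <
      #|[set e in E | e.1 == w]| + #|[set e in E | e.2 == w]|.
    move=> wS; have := deg w wS; rewrite -ltnNge => /leq_trans; apply.
    have -> : [set u in S | B w u || B u w] =
        (snd @: [set e in E | e.1 == w]) :|: (fst @: [set e in E | e.2 == w]).
      apply/setP => u; rewrite !inE; apply/andP/orP => [[uS /orP[wu|uw]]|].
      - by left; apply/imsetP; exists (w, u); rewrite // !inE wS uS wu /=.
      - by right; apply/imsetP; exists (u, w); rewrite // !inE wS uS uw /=.
      - by case=> /imsetP[[x y] /=]; rewrite !inE /= => /andP[/and3P[xS yS xy]
          /eqP <-] ->; rewrite ?xS ?yS xy ?orbT.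
    apply: leq_trans (leq_card_setU _ _) _.
    by rewrite leq_add // leq_imset_card.
  (* One vertex of the nonempty [S] is split off to keep the inequality strict. *)
  rewrite (bigD1 v vS) [X in _ < X](bigD1 v vS) /=.
  rewrite -addSn leq_add ?le_deg // leq_sum // => w /andP[wS _].
  by rewrite ltnW ?le_deg.
have [|E' [E'E E'0 out_deg in_deg]] := @dense_core _ _ fst snd a b E.
  apply: leq_ltn_trans ltE; rewrite mulnDl.
  by rewrite leq_add // leq_mul // subset_leq_card.
exists E'; split=> // e eE'.
- by have := subsetP E'E e eE'; rewrite inE => /and3P[].
- apply: leq_trans (out_deg e eE') _.
  rewrite -(@card_imset _ _ (pair e.1) [set z | (e.1, z) \in E']) => [|z z' [] //].
  apply/subset_leq_card/subsetP => -[x y]; rewrite inE => /andP[xyE /= /eqP xe].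
  by rewrite -xe imset_f // inE.
- apply: leq_trans (in_deg e eE') _.
  rewrite -(@card_imset _ _ (pair^~ e.2) [set z | (z, e.2) \in E']) => [|z z' [] //].
  apply/subset_leq_card/subsetP => -[x y]; rewrite inE => /andP[xyE /= /eqP ye].
  by rewrite -ye (imset_f (pair^~ y)) // inE.
Qed.

Theorem theorem8 (D : digraph) :
  strongly_connected D ->
  ~ has_subdivision antidirected_C6 D ->
  chromatic_number D <= 7 * 16 ^ 2.
Proof.
move=> strong no_C6.
(* Level parity times 23 colours gives 46 colours, well within the bound. *)
suff col : colorable D #|{: bool * 'I_23}|.
  rewrite /chromatic_number; case: ex_minnP => m _ /(_ _ col) /leq_trans.
  by apply; rewrite card_prod card_bool card_ord.
have [r _|D0] := pickP (mem [set: D]); last first.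
  by apply: (@colorable_card D _ (fun=> (true, ord0))) => x; have := D0 x; rewrite !inE.
have [lev [par [lev0 parP lev_arc]]] := exists_bfs_tree (strong r).
pose B : rel D := fun x y => arc x y && (lev y <= lev x).
(* Here 22 is [2 * (9 + 2)], from the strict bounds 9 and 2 on out- and in-degrees. *)
have [||S S0|c cP] := @degenerate_coloring D (fun x y => B x y || B y x) 22.
- by move=> x y; rewrite orbC.
- by move=> x; rewrite /B arc_irr.
- have [//|[E [EB E0 out_deg in_deg]]] := degenerate_or_dense_core B 9 2 S0.
  case/eqP: E0; apply: (no_dense_back_arcs lev0 parP no_C6) => // e /EB.
  by move=> /andP[].
apply: (@colorable_card D _ (fun x => (odd (lev x), c x))) => x y.
rewrite /adjacent /= xpair_eqE negb_and; apply: contraTT => /norP.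
rewrite !negbK => -[/eqP lev_xy c_xy].
suff back u w : odd (lev u) = odd (lev w) -> arc u w -> B u w.
  apply: contraL c_xy => /orP[/back|/back] Buw; apply: cP.
    by rewrite Buw.
  by rewrite Buw ?orbT.
(* An arc that raises the level raises it by exactly one, which changes the parity. *)
move=> luw uw; rewrite /B uw leqNgt; apply/negP => ltuw.
have /eqP E : lev w == (lev u).+1 by rewrite eqn_leq lev_arc.
by move: luw; rewrite E /=; case: odd.
Qed.
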